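(* Consider an instance of the Maximum Coverage Problem with Knapsack Constraints and its linear relaxation (LP) as in the context, and let $(x^*,y^* )$ be an optimal solution of (LP). Then there exists a feasible solution $(x,y)$ of (LP) such that $x$ satisfies the bounded split property and $F(x)\ge F(x^* )$, where $F(x)=\sum_{i\in\mathcal{I}}p_i\big(1-\prod_{j\in\mathcal{S}(i)}(1-\sum_{k\in\mathcal{K}}x_{jk})\big)$.
   Context: Instance: items $\mathcal{I}=[n]$ with profits $p_i>0$; sets $S_1,\dots,S_m\subseteq\mathcal{I}$ (identified with $\mathcal{S}=[m]$) with costs $c_j>0$; knapsacks $\mathcal{K}=[p]$ with capacities $B_k>0$; $\mathcal{S}(i)=\{j: i\in S_j\}$. (LP): variables $x_{jk}$ for $j\in\mathcal{S}$, $k\in\mathcal{K}$ with $B_k\ge c_j$ (other $x_{jk}$ absent, i.e. $0$), and $y_i$, $i\in\mathcal{I}$; maximize $\sum_i p_iy_i$ subject to $\sum_j c_jx_{jk}\le B_k$ ($k\in\mathcal{K}$), $\sum_k x_{jk}\le1$ ($j\in\mathcal{S}$), $\sum_{j\in\mathcal{S}(i)}\sum_k x_{jk}\ge y_i$ ($i\in\mathcal{I}$), $x,y\in[0,1]$. The support graph of $x$ is the bipartite graph $H_x$ with node sets $\mathcal{S}$ and $\mathcal{K}$ and edge set $E_x=\{\{j,k\}: 0<x_{jk}<1\}$. A matching $M\subseteq E_x$ is $\mathcal{S}$-saturating if every non-isolated node $j\in\mathcal{S}$ of $H_x$ is covered by an edge of $M$. A feasible $x$ satisfies the bounded split property if $H_x$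 has an $\mathcal{S}$-saturating matching. The empty product equals $1$. *)

(* Defs.v *)
From mathcomp Require Import all_boot all_order all_algebra.

Set Implicit Arguments.
Unset Strict Implicit.
Unset Printing Implicit Defensive.

Import Order.TTheory GRing.Theory Num.Theory.
Local Open Scope ring_scope.

(* Maximum coverage with knapsack constraints: n items, m sets, q knapsacks. *)
Record instance (R : realFieldType) (n m q : nat) := Instance {
  profit : 'I_n -> R;
  cover : 'I_m -> {set 'I_n};
  cost : 'I_m -> R;
  capacity : 'I_q -> R;
  profit_gt0 : forall i, 0 < profit i;
  cost_gt0 : forall j, 0 < cost j;
  capacity_gt0 : forall k, 0 < capacity k
}.

Section MaxCoverage.

Variables (R : realFieldType) (n m q : nat) (I : instance R n m q).

Implicit Types (x : 'I_m -> 'I_q -> R) (y : 'I_n -> R).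

(* The variable x j k exists in the linear program only if c_j <= B_k; the
   absent variables are represented by entries constrained to be 0. *)
Record lp_feasible x y : Prop := LpFeasible {
  lp_absent : forall j k, capacity I k < cost I j -> x j k = 0;
  lp_capacity : forall k, \sum_(j < m) cost I j * x j k <= capacity I k;
  lp_assign : forall j, \sum_(k < q) x j k <= 1;
  lp_cover : forall i,
    y i <= \sum_(j < m | i \in cover I j) \sum_(k < q) x j k;
  lp_x01 : forall j k, 0 <= x j k <= 1;
  lp_y01 : forall i, 0 <= y i <= 1
}.

Definition lp_value y : R := \sum_(i < n) profit I i * y i.

Definition lp_optimal x y : Prop :=
  lp_feasible x y /\
  forall x' y', lp_feasible x' y' -> lp_value y' <= lp_value y.

(* The edge {j, k} of the bipartite support graph is the pair (j, k). *)
Definition support_edges x : {set 'I_m * 'I_q} :=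
  [set e | 0 < x e.1 e.2 < 1].

Definition matching (M : {set 'I_m * 'I_q}) : Prop :=
  forall e f, e \in M -> f \in M -> e != f -> e.1 != f.1 /\ e.2 != f.2.

Definition non_isolated x (j : 'I_m) : Prop :=
  exists k, (j, k) \in support_edges x.

Definition set_saturating x (M : {set 'I_m * 'I_q}) : Prop :=
  forall j, non_isolated x j -> exists k, (j, k) \in M.

Definition bounded_split x : Prop :=
  exists M : {set 'I_m * 'I_q},
    [/\ M \subset support_edges x, matching M & set_saturating x M].

Definition F x : R :=
  \sum_(i < n) profit I i *
    (1 - \prod_(j < m | i \in cover I j) (1 - \sum_(k < q) x j k)).

End MaxCoverage.

(* Main.v *)
(* The objective F depends on x only through its row sums, so y = 0 may be used
   throughout and the optimality of the given solution is irrelevant.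

   Let A be the matrix whose rows are the fractional edges and whose columns are
   the knapsacks (entries c_j) and the sets of degree at least 2 in H_x
   (entries 1).  If the rows of A are independent, a nonzero maximal minor
   assigns to each fractional edge one of its end nodes, injectively and never a
   set of degree 1.  A set of degree at least 2 absorbs at most one of its edges,
   hence every non-isolated set has an edge assigned to its knapsack end, and
   these edges form the required matching.

   Otherwise let d be a row dependency of minimal support.  Moving x along d
   preserves the knapsack loads and the row sums of the sets of degree at least
   2; by minimality, double counting shows that at most two row sums change, and
   they change in opposite directions.  Hence F is convex along d, so that it is
   nondecreasing along d or -d, and one moves until a fractional entry becomes
   integral. *)
Require Import Defs.
From mathcomp Require Import all_boot all_order fingroup perm all_algebra.
From mathcomp Require Import zify ring lra.
Import Order.TTheory GRing.Theory Num.Theory.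
Local Open Scope ring_scope.

(** * Row dependencies and transversals over a field *)

(** For independent rows, a nonzero maximal minor has a nonzero Leibniz term, whose permutation
    matches the rows in [D] with distinct columns. [c0] is only the value of [g] outside [D]. *)
Lemma dependent_or_transversal (K : fieldType) (T C : finType)
    (A : T -> C -> K) (D : {set T}) (c0 : C) :
  (exists d : T -> K, [/\ exists e, d e != 0, forall e, e \notin D -> d e = 0
     & forall c, \sum_e d e * A e c = 0]) \/
  (exists g : T -> C, {in D &, injective g} /\
     {in D, forall e, A e (g e) != 0}).
Proof.
pose B : 'M[K]_(#|D|, #|C|) := \matrix_(e, c) A (enum_val e) (enum_val c).
have [freeB | dep] := boolP (row_free B); last first.
  left; move: dep; rewrite -kermx_eq0 -nz_row_eq0.
  set v := nz_row _ => nzv.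
  have vB : v *m B = 0 by apply/sub_kermxP/nz_row_sub.
  (* The sum has at most one term: it extends [v] by zero outside [D]. *)
  exists (fun e => \sum_(i < #|D| | enum_val i == e) v 0 i); split.
  - have /existsP[i nzi] : [exists i, v 0 i != 0].
      apply: contraNT nzv; rewrite negb_exists => /forallP v0.
      by apply/eqP/rowP=> i; rewrite mxE; apply/eqP; rewrite -[_ == _]negbK.
    exists (enum_val i); rewrite (big_pred1 i) // => j.
    by rewrite /= (inj_eq enum_val_inj).
  - move=> e De; rewrite big_pred0 // => i; apply: contraNF De => /eqP <-.
    exact: enum_valP.
  - move=> c; transitivity ((v *m B) 0 (enum_rank c)); last by rewrite vB mxE.
    rewrite mxE (partition_big (@enum_val T (mem D)) xpredT) //=.
    apply: eq_bigr => e _; rewrite mulr_suml; apply: eq_bigr => i /eqP <-.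
    by rewrite mxE enum_rankK.
right; have fullBT : row_full B^T by rewrite /row_full mxrank_tr.
have := fullrowsub_unit fullBT; rewrite unitmxE unitfE.
set f := fullrankfun fullBT => det_nz.
have /existsP[s /forallP nzs] :
    [exists s : {perm 'I_#|D|}, [forall i, rowsub f B^T i (s i) != 0]].
  apply: contraNT det_nz => /existsPn all0; apply/eqP/big1 => s _.
  have /forallPn[i] := all0 s; rewrite negbK => /eqP Bi0.
  by rewrite (bigD1 i) //= Bi0 mul0r mulr0.
exists (fun e => if [pick i | enum_val (s i) == e] is Some i
                 then enum_val (f i) else c0).
have gE e : e \in D -> exists2 i, enum_val (s i) = e &
    [pick i | enum_val (s i) == e] = Some i.
  move=> De; case: pickP => [i /eqP <-|noi]; first by exists i.
  by have := noi ((s^-1)%g (enum_rank_in De e));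
    rewrite permKV enum_rankK_in ?eqxx.
split=> [e1 e2 De1 De2|e De].
  have [i1 <- ->] := gE _ De1; have [i2 <- ->] := gE _ De2.
  by move=> /enum_val_inj/(@fullrankfun_inj _ _ _ _ fullBT) ->.
by have [i <- ->] := gE _ De; have := nzs i; rewrite !mxE.
Qed.

(** Minimality of the support is recorded by [g]: if the support without [e0] still has dependent
    rows, the induction passes to that smaller set; otherwise it has a transversal. *)
Lemma minimal_dependency (K : fieldType) (T C : finType) (A : T -> C -> K)
    (D : {set T}) (c0 : C) (d : T -> K) :
    (exists e, d e != 0) -> (forall e, e \notin D -> d e = 0) ->
    (forall c, \sum_e d e * A e c = 0) ->
  exists d' e0 (g : T -> C), [/\ d' e0 != 0,
    forall e, e \notin D -> d' e = 0, forall c, \sum_e d' e * A e c = 0,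
    {in [set e | d' e != 0] :\ e0 &, injective g} &
    {in [set e | d' e != 0] :\ e0, forall e, A e (g e) != 0}].
Proof.
have [k] := ubnP #|D|; elim: k => // k IH in D d *; rewrite ltnS => Dk.
move=> [e0 de0] dD dA; set S := [set e | d e != 0].
have SD : S \subset D.
  by apply/subsetP=> e; rewrite inE; apply: contraNT => /dD ->.
have [[d1 [nz1 dS1 dA1]] | [g [gi gA]]] :=
    dependent_or_transversal _ _ _ A (S :\ e0) c0; last by exists d, e0, g.
have Sk : (#|S :\ e0| < k)%N.
  apply: leq_trans Dk; rewrite (leq_trans _ (subset_leq_card SD)) //.
  by rewrite [leqRHS](cardsD1 e0) inE de0.
have [d' [e1 [g [? d'S ? ? ?]]]] := IH _ _ Sk nz1 dS1 dA1.
exists d', e1, g; split=> // e De; apply: d'S; apply: contraNN De.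
by rewrite inE => /andP[_ /(subsetP SD)].
Qed.

(** * The incidence matrix of the support graph and the matching *)

Section Incidence.

Context (R : realFieldType) (n m q : nat) (I : instance R n m q).
Implicit Types (x : 'I_m -> 'I_q -> R) (d : 'I_m * 'I_q -> R).

Definition degree x (j : 'I_m) : nat :=
  #|[set k | (j, k) \in support_edges x]|.

(* Set nodes of degree at most 1 get a zero column: their row sums are free. *)
Definition incidence x (e : 'I_m * 'I_q) (c : 'I_q + 'I_m) : R :=
  match c with
  | inl k => if e.2 == k then cost I e.1 else 0
  | inr j => if (e.1 == j) && (1 < degree x j)%N then 1 else 0
  end.

Lemma incidence_inl x e k : (incidence x e (inl k) != 0) = (e.2 == k).
Proof. by rewrite /=; case: ifP => _; rewrite ?eqxx // gt_eqF ?cost_gt0. Qed.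

Lemma incidence_inr x e j :
  (incidence x e (inr j) != 0) = (e.1 == j) && (1 < degree x j)%N.
Proof. by rewrite /=; case: ifP => _; rewrite ?eqxx ?oner_eq0. Qed.

Lemma sum_edges d : \sum_e d e = \sum_j \sum_k d (j, k).
Proof. by rewrite pair_bigA; apply: eq_bigr => -[]. Qed.

Lemma sum_incidence_inl x d k :
  \sum_e d e * incidence x e (inl k) = \sum_j cost I j * d (j, k).
Proof.
rewrite sum_edges.
apply: eq_bigr => j _; rewrite (bigD1 k) //= eqxx mulrC big1 ?addr0 // => k'.
by move=> /negPf->; rewrite mulr0.
Qed.

Lemma sum_incidence_inr x d j : (1 < degree x j)%N ->
  \sum_e d e * incidence x e (inr j) = \sum_k d (j, k).
Proof.
move=> degj.
rewrite sum_edges.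
rewrite (bigD1 j) //= eqxx degj [X in _ + X]big1 ?addr0.
  by apply: eq_bigr => k _; rewrite mulr1.
by move=> j' /negPf->; rewrite big1 // => k _; rewrite mulr0.
Qed.

Lemma bounded_split_of_transversal x (g : 'I_m * 'I_q -> 'I_q + 'I_m) :
    {in support_edges x &, injective g} ->
    {in support_edges x, forall e, incidence x e (g e) != 0} ->
  bounded_split x.
Proof.
move=> gi gA.
(* Of the edges assigned to their knapsack end, [h] keeps at most one per set; injectivity of [g]
   separates the knapsacks. *)
pose h j := [pick k | ((j, k) \in support_edges x) && (g (j, k) == inl k)].
have hP e : h e.1 = Some e.2 -> e \in support_edges x /\ g e = inl e.2.
  case: e => j k; rewrite /h /=; case: pickP => // k' /andP[Ek /eqP gk] [kk].
  by rewrite -kk.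
exists [set e | h e.1 == Some e.2]; split.
- by apply/subsetP=> e; rewrite inE => /eqP/hP[].
- move=> [j k] [j' k']; rewrite !inE => /eqP he /eqP hf ef.
  have [Ee ge] := hP _ he; have [Ef gf] := hP _ hf.
  split; apply: contra_neq ef => /= ejk.
    by move: he hf => /=; rewrite ejk => -> [->].
  by apply: gi; rewrite // ge gf /= ejk.
move=> j [k0 Ek0]; case hj: (h j) => [k|]; first by exists k; rewrite inE /= hj.
(* If [h j] is empty, all edges at [j] go to [inr j]; there are at least two of them, against
   injectivity. *)
have g_inr k : (j, k) \in support_edges x ->
    g (j, k) = inr j /\ (1 < degree x j)%N.
  move=> Ek; have := gA _ Ek; case gk: (g (j, k)) => [k'|j'].
    rewrite incidence_inl /= => /eqP kk; move: hj; rewrite /h.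
    by case: pickP => // /(_ k); rewrite Ek gk kk eqxx.
  by rewrite incidence_inr => /andP[/eqP /= <-].
have [_ /card_gt1P[k1 [k2 []]]] := g_inr _ Ek0.
rewrite in_set => E1; rewrite in_set => E2; case/eqP.
have [[g1 _] [g2 _]] := (g_inr _ E1, g_inr _ E2).
by have [] : (j, k1) = (j, k2) by apply: gi; rewrite // g1 g2.
Qed.

(** * Row sums and the objective along a minimal dependency *)

(* Double counting of the support S of d: every node of the range of g has
   degree at least 2 in S, so that 2 #|S| is at least 2 (#|S| - 1) plus the
   number of sets with a nonzero row sum. *)
Lemma card_row_sum_neq0 x d e0 (g : 'I_m * 'I_q -> 'I_q + 'I_m) :
    d e0 != 0 -> (forall c, \sum_e d e * incidence x e c = 0) ->
    {in [set e | d e != 0] :\ e0 &, injective g} ->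
    {in [set e | d e != 0] :\ e0, forall e, incidence x e (g e) != 0} ->
  (#|[set j | (\sum_k d (j, k) != 0)%R]| <= 2)%N.
Proof.
set S := [set e | d e != 0] => de0 dA gi gA.
(* In a vanishing column sum, a nonzero term needs a second one to cancel it. *)
have deg2 c : c \in g @: (S :\ e0) ->
    (1 < #|[set e in S | (incidence x e c != 0)%R]|)%N.
  case/imsetP=> e1 Se1 ->; have Ae1 := gA _ Se1.
  have de1 : d e1 != 0 by move: Se1; rewrite !inE => /andP[].
  apply/card_gt1P; have /existsP[e2 /andP[e21 nz2]] :
      [exists e2, (e2 != e1) && (d e2 * incidence x e2 (g e1) != 0)].
    apply: contraT => /existsPn all0; have /eqP := dA (g e1).
    rewrite (bigD1 e1) //= big1 ?addr0.
      by rewrite mulf_eq0 (negPf de1) (negPf Ae1).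
    by move=> e2 e21; have := all0 e2; rewrite e21 /= negbK => /eqP.
  exists e1, e2; split; rewrite 1?eq_sym // !inE ?de1 ?Ae1 //.
  by move: nz2; rewrite mulf_eq0 negb_or.
have boundK (k : 'I_q) :
    (2 * (inl k \in g @: (S :\ e0)) <= #|[set e in S | e.2 == k]|)%N.
  case: (boolP (inl k \in _)) => // /deg2 /leq_trans-> //.
  by apply/subset_leq_card/subsetP=> e; rewrite !inE incidence_inl.
(* At a set in the range of [g] the row sum vanishes; any other set with nonzero row sum still has
   an edge in [S]. *)
have boundJ (j : 'I_m) :
    (2 * (inr j \in g @: (S :\ e0)) + (\sum_k d (j, k) != 0)%R
       <= #|[set e in S | e.1 == j]|)%N.
  case: (boolP (inr j \in _)) => [jg|_].
    have /card_gt1P[e [_ [+ _ _]]] := deg2 _ jg.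
    rewrite inE incidence_inr => /andP[_ /andP[_ degj]].
    rewrite -(sum_incidence_inr x) // dA eqxx; apply: leq_trans (deg2 _ jg) _.
    apply/subset_leq_card/subsetP=> e'; rewrite !inE incidence_inr.
    by move=> /andP[-> /andP[-> _]].
  have [//|nz] := eqVneq (\sum_k d (j, k)) 0; rewrite card_gt0; apply/set0Pn.
  have /existsP[k nzk] : [exists k, d (j, k) != 0].
    apply: contraNT nz => /existsPn all0; apply/eqP/big1 => k _.
    by apply/eqP; rewrite -[_ == _]negbK all0.
  by exists (j, k); rewrite !inE nzk eqxx.
have cardK : #|S| = (\sum_k #|[set e in S | e.2 == k]|)%N.
  rewrite -sum1_card (partition_big snd xpredT) //=.
  by apply: eq_bigr => k _; rewrite -sum1_card;
    apply: eq_bigl => e; rewrite !inE.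
have cardJ : #|S| = (\sum_j #|[set e in S | e.1 == j]|)%N.
  rewrite -sum1_card (partition_big fst xpredT) //=.
  by apply: eq_bigr => j _; rewrite -sum1_card;
    apply: eq_bigl => e; rewrite !inE.
(* The successor accounts for [e0], the row left out of the transversal. *)
have cardg : #|S| = (\sum_k (inl k \in g @: (S :\ e0))
                     + \sum_j (inr j \in g @: (S :\ e0))).+1.
  rewrite (cardsD1 e0) inE de0 add1n -(card_in_imset gi) -sum1_card.
  by rewrite big_mkcond big_sumType /=; congr (_ + _).+1;
    apply: eq_bigr => c _; case: ifP.
have leK : (2 * \sum_k (inl k \in g @: (S :\ e0)) <= #|S|)%N.
  by rewrite cardK big_distrr leq_sum.
have leJ : (2 * \sum_j (inr j \in g @: (S :\ e0))
            + #|[set j | (\sum_k d (j, k) != 0)%R]| <= #|S|)%N.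
  rewrite [leqRHS]cardJ big_distrr -sum1_card.
  rewrite [X in (_ + X)%N]big_mkcond -big_split.
  by apply: leq_sum => j _; apply: leq_trans (boundJ j); rewrite inE; case: ifP.
lia.
Qed.

(* Along d the objective is quadratic with nonnegative leading coefficient:
   for each item the coefficient of t^2 is - s a * s b times a product of
   factors 1 - z j >= 0. *)
Lemma coverage_chord (z s : 'I_m -> R) (a b : 'I_m) :
    (forall j, z j <= 1) -> a != b -> (forall j, j != a -> j != b -> s j = 0) ->
    s a * s b <= 0 ->
  exists l : R, forall t,
    \sum_(i < n) profit I i * (1 - \prod_(j < m | i \in Defs.cover I j) (1 - z j))
      + l * t
    <= \sum_(i < n) profit I i *
         (1 - \prod_(j < m | i \in Defs.cover I j) (1 - (z j + t * s j))).
Proof.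
move=> z1 ab s0 sab.
(* Sets that miss item [i] get the constant factor 1, so the factors at [a] and [b] can always be
   split off. *)
pose w i j := if i \in Defs.cover I j then 1 - z j else 1.
pose u i j := if i \in Defs.cover I j then s j else 0.
pose Q i := \prod_(j | (j != a) && (j != b)) w i j.
(* The slope is the derivative at [t = 0]. *)
exists (\sum_i profit I i * ((u i a * w i b + u i b * w i a) * Q i)) => t.
rewrite mulr_suml -big_split; apply: ler_sum => i _ /=.
have prodE t' : \prod_(j < m | i \in Defs.cover I j) (1 - (z j + t' * s j))
    = (w i a - t' * u i a) * ((w i b - t' * u i b) * Q i).
  rewrite big_mkcond (bigD1 a) //= (bigD1 b) 1?eq_sym //= /w /u.
  congr (_ * (_ * _)); first by case: ifP => _; ring.
    by case: ifP => _; ring.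
  by apply: eq_bigr => j /andP[ja jb]; rewrite s0 // mulr0 addr0.
have prod0 : \prod_(j < m | i \in Defs.cover I j) (1 - z j)
    = w i a * (w i b * Q i).
  transitivity (\prod_(j < m | i \in Defs.cover I j) (1 - (z j + 0 * s j))).
    by apply: eq_bigr => j _; rewrite mul0r addr0.
  by rewrite prodE !mul0r !subr0.
have Q0 : 0 <= Q i.
  by apply: prodr_ge0 => j _; rewrite /w; case: ifP => _; rewrite ?subr_ge0.
have uab : u i a * u i b <= 0.
  by rewrite /u; case: ifP; case: ifP; rewrite ?mul0r ?mulr0.
rewrite prodE prod0 -mulrA -mulrDr ler_pM2l ?profit_gt0 // -subr_ge0.
have -> : 1 - (w i a - t * u i a) * ((w i b - t * u i b) * Q i) -
    (1 - w i a * (w i b * Q i) + (u i a * w i b + u i b * w i a) * Q i * t)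
  = (- (u i a * u i b)) * (t ^+ 2 * Q i) by ring.
by rewrite mulr_ge0 ?oppr_ge0 // mulr_ge0 ?sqr_ge0.
Qed.

(** Constant loads make the cost-weighted row sums of [d] add up to zero, so a single nonzero one is
    impossible and two have opposite signs. The sign [c] then makes the slope of the chord
    nonnegative. *)
Lemma F_ascent x d e0 (g : 'I_m * 'I_q -> 'I_q + 'I_m) :
    (forall j, \sum_k x j k <= 1) ->
    d e0 != 0 -> (forall c, \sum_e d e * incidence x e c = 0) ->
    {in [set e | d e != 0] :\ e0 &, injective g} ->
    {in [set e | d e != 0] :\ e0, forall e, incidence x e (g e) != 0} ->
  exists2 c : R, c = 1 \/ c = -1 & forall t, 0 <= t ->
    F I x <= F I (fun j k => x j k + t * (c * d (j, k))).
Proof.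
move=> x1 de0 dA gi gA; have := card_row_sum_neq0 _ _ _ _ de0 dA gi gA.
set L := [set j | _] => L2; pose s j := \sum_k d (j, k).
have sumE t c j : \sum_k (x j k + t * (c * d (j, k)))
    = \sum_k x j k + t * (c * s j).
  by rewrite big_split /= -!mulr_sumr.
have inL j : j \notin L -> s j = 0 by rewrite inE negbK => /eqP.
have balance : \sum_j cost I j * s j = 0.
  under eq_bigr => j _ do rewrite mulr_sumr.
  by rewrite exchange_big big1 // => k _; rewrite -(sum_incidence_inl x) dA.
have [L0|] := eqVneq L set0.
  exists 1; first by left.
  move=> t _; rewrite /F le_eqVlt; apply/orP; left; apply/eqP.
  apply: eq_bigr => i _; congr (_ * (1 - _)); apply: eq_bigr => j _.
  by rewrite sumE inL ?L0 ?inE // !mulr0 addr0.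
rewrite -card_gt0 => Lgt0.
have [L1 | Ln1] := eqVneq #|L| 1%N.
  have /eqP/cards1P[a La] := L1; have : a \in L by rewrite La set11.
  have aj j : j != a -> s j = 0 by move=> ja; rewrite inL // La inE.
  move: balance; rewrite (bigD1 a) //= big1 => [|j /aj ->]; last first.
    by rewrite mulr0.
  move/eqP; rewrite addr0 mulf_eq0 gt_eqF ?cost_gt0 //= => /eqP sa0.
  by rewrite inE -/(s a) sa0 eqxx.
have /cards2P[a [b [ab Lab]]] : #|L| == 2 by lia.
have s0 j : j != a -> j != b -> s j = 0.
  by move=> ja jb; rewrite inL // Lab !inE negb_or ja.
have sab : s a * s b <= 0.
  move: balance; rewrite (bigD1 a) //= (bigD1 b) 1?eq_sym //= big1; last first.
    by move=> j /andP[ja jb]; rewrite s0 ?mulr0.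
  rewrite addr0 => /eqP; rewrite addr_eq0 => /eqP bal.
  rewrite -(pmulr_rle0 _ (cost_gt0 I a)) mulrA bal mulNr oppr_le0 -mulrA.
  by rewrite -expr2 mulr_ge0 ?sqr_ge0 ?ltW ?cost_gt0.
have [l lP] := coverage_chord _ _ _ _ x1 ab s0 sab.
have FE t c : F I (fun j k => x j k + t * (c * d (j, k))) =
    \sum_(i < n) profit I i *
      (1 - \prod_(j < m | i \in Defs.cover I j)
             (1 - (\sum_k x j k + t * c * s j))).
  apply: eq_bigr => i _; congr (_ * (1 - _)); apply: eq_bigr => j _.
  by rewrite sumE mulrA.
have [l0 | l0] := leP 0 l.
  exists 1; [by left|move=> t t0; rewrite FE].
  apply: le_trans (lP _); rewrite lerDl; nra.
exists (-1); [by right|move=> t t0; rewrite FE].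
apply: le_trans (lP _); rewrite lerDl; nra.
Qed.

(** * Moving to an integral entry, and the induction on fractional edges *)

Lemma integral_step x d :
    lp_feasible I x (fun=> 0) -> (exists e, d e != 0) ->
    (forall e, e \notin support_edges x -> d e = 0) ->
    (forall k, \sum_j cost I j * d (j, k) = 0) ->
    (forall j, (1 < degree x j)%N -> \sum_k d (j, k) = 0) ->
  exists2 t, 0 <= t & let x' := fun j k => x j k + t * d (j, k) in
    lp_feasible I x' (fun=> 0) /\
    (#|support_edges x'| < #|support_edges x|)%N.
Proof.
move=> [absent capa assign _ x01 _] [e0 de0] dE load0 row0.
(* Ratio test: [r e] is the time at which a growing entry reaches 1 or a shrinking one reaches 0.
   The minimum makes one entry integral and keeps all of them between 0 and 1. *)
pose r e := if 0 < d e then (1 - x e.1 e.2) / d e else - x e.1 e.2 / d e.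
case: (@Order.TotalTheory.arg_minP _ _ _ e0 (fun e => d e != 0) r de0)
  => e1 de1 r_min.
have dE' e : d e != 0 -> 0 < x e.1 e.2 < 1.
  move=> de; suff : e \in support_edges x by rewrite inE.
  by apply: contraNT de => /dE ->.
have t0 : 0 <= r e1.
  have /andP[xe0 xe1] := dE' _ de1; rewrite /r; case: ltP => [d0|d0].
    by rewrite divr_ge0 ?subr_ge0 ?ltW.
  by rewrite mulr_le0 ?oppr_le0 ?invr_le0 // ltW.
exists (r e1) => // x'.
have x'01 j k : 0 <= x' j k <= 1.
  rewrite /x'; have [->|djk] := eqVneq (d (j, k)) 0.
    by rewrite mulr0 addr0.
  have /andP[/ltW xe0 /ltW xe1] := dE' _ djk.
  have := r_min (j, k) djk; rewrite {2}/r /=.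
  have [d0 | d0] := ltP 0 (d (j, k)).
    rewrite ler_pdivlMr // => le_t.
    have : 0 <= r e1 * d (j, k) by rewrite mulr_ge0 // ltW.
    by move: xe0 xe1 => /=; lra.
  rewrite ler_ndivlMr ?lt_neqAle ?djk // => le_t.
  have : r e1 * d (j, k) <= 0 by rewrite mulr_ge0_le0.
  by move: xe0 xe1 => /=; lra.
split; last first.
  apply/proper_card/properP; split.
    apply/subsetP=> e; apply: contraTT => Ee; move: (Ee).
    by rewrite !inE /x' -surjective_pairing dE // mulr0 addr0.
  exists e1; first by rewrite inE dE'.
  rewrite inE /x' -surjective_pairing /r; case: ifP => _; rewrite divfK //.
    by rewrite addrC subrK ltxx andbF.
  by rewrite subrr ltxx.
split=> // [j k lt_k | k | j | i | i]; last by rewrite lexx ler01.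
- by rewrite /x' dE ?mulr0 ?addr0 ?absent // inE /= absent ?ltxx.
- rewrite /x'; under eq_bigr => j _ do rewrite mulrDr mulrCA.
  by rewrite big_split /= -mulr_sumr load0 mulr0 addr0.
- have [le1|/row0 dj0] := leqP (degree x j) 1; last first.
    by rewrite /x' big_split /= -mulr_sumr dj0 mulr0 addr0.
  have [E0|[k0]] := set_0Vmem [set k | (j, k) \in support_edges x].
    rewrite /x' (eq_bigr (x j)) // => k _; rewrite dE ?mulr0 ?addr0 //.
    by have := in_set0 k; rewrite -E0 in_set => ->.
  rewrite in_set => Ek0; have notE k : k != k0 -> (j, k) \notin support_edges x.
    move=> kk0; apply: contraTN le1 => Ek; rewrite -ltnNge.
    by apply/card_gt1P; exists k, k0; split=> //; rewrite in_set.
  (* An entry 1 beside the fractional [x j k0] would violate [assign], so the new row sum is the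
     single entry [x' j k0]. *)
  have xk0 k : k != k0 -> x j k = 0.
    move=> kk0; have := notE _ kk0; rewrite inE /= negb_and -!leNgt.
    case/orP=> [xle0|xge1].
      by apply/eqP; rewrite eq_le xle0; case/andP: (x01 j k).
    have := assign j; rewrite (bigD1 k) //= (bigD1 k0) 1?eq_sym //=.
    have : 0 <= \sum_(i | (i != k) && (i != k0)) x j i.
      by apply: sumr_ge0 => i _; case/andP: (x01 j i).
    by move: Ek0; rewrite inE /= => /andP[]; lra.
  rewrite (bigD1 k0) //= big1 ?addr0; first by case/andP: (x'01 j k0).
  by move=> k kk0; rewrite /x' xk0 // dE ?notE // mulr0 addr0.
- by apply: sumr_ge0 => j _; apply: sumr_ge0 => k _; case/andP: (x'01 j k).
Qed.

Lemma exists_bounded_split x : lp_feasible I x (fun=> 0) ->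
  exists2 x', lp_feasible I x' (fun=> 0) & bounded_split x' /\ F I x <= F I x'.
Proof.
have [N] := ubnP #|support_edges x|; elim: N => // N IH in x *.
rewrite ltnS => xN feas.
(* Without fractional entries the empty matching works; otherwise an edge supplies the default
   column [inl e0.2]. *)
have [E0|[e0 Ee0]] := set_0Vmem (support_edges x).
  exists x => //; split=> //; exists set0; split.
  - exact: sub0set.
  - by move=> e f; rewrite inE.
  - by move=> j [k]; rewrite E0 inE.
have [[d [dnz dE dA]] | [g [gi gA]]] :=
    dependent_or_transversal _ _ _ (incidence x) (support_edges x) (inl e0.2);
  last first.
  by exists x => //; split; [exact: bounded_split_of_transversal gi gA|].
have {d dnz dE dA} [d [e1 [g [de1 dE dA gi gA]]]] :=
  minimal_dependency _ _ _ _ _ (inl e0.2) _ dnz dE dA.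
have [c c1 Fle] := F_ascent _ _ _ _ (lp_assign feas) de1 dA gi gA.
(* The ascent holds for every [t >= 0], so the step length may be dictated by feasibility alone. *)
have [||||t t0 [feas' lt_E]] := integral_step x (fun e => c * d e) feas.
- by exists e1; case: c1 => ->; rewrite ?mul1r ?mulN1r ?oppr_eq0.
- by move=> e /dE ->; rewrite mulr0.
- move=> k; under eq_bigr => j _ do rewrite mulrCA.
  by rewrite -mulr_sumr -(sum_incidence_inl x) dA mulr0.
- by move=> j dj; rewrite -mulr_sumr -(sum_incidence_inr x) // dA mulr0.
have [x' feas'' [bs leF]] := IH _ (leq_trans lt_E xN) feas'.
by exists x' => //; split=> //; apply: le_trans leF; apply: Fle.
Qed.

End Incidence.

Theorem theorem1 (R : realFieldType) (n m q : nat) (I : instance R n m q)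
    (xs : 'I_m -> 'I_q -> R) (ys : 'I_n -> R) :
  lp_optimal I xs ys ->
  exists (x : 'I_m -> 'I_q -> R) (y : 'I_n -> R),
    [/\ lp_feasible I x y, bounded_split x & F I xs <= F I x].
Proof.
case=> [[absent capa assign _ x01 _] _].
have [|x feas [bs leF]] := exists_bounded_split _ _ _ _ I xs;
  last by exists x, (fun=> 0).
split=> // [i|i]; last by rewrite lexx ler01.
by apply: sumr_ge0 => j _; apply: sumr_ge0 => k _; case/andP: (x01 j k).
Qed.
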